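(* Let $h\ge0$, $\ell\ge1$, let $b_1,\ldots,b_h,a_1,\ldots,a_\ell$ be positive integers, let $\beta=[0;b_1,\ldots,b_h,\overline{a_1,\ldots,a_\ell}]$, and for $k=1,\ldots,\ell$ let $C_k=\lim_{m\to\infty}P_{q_{h+m\ell+k}}(\beta)$. If $C_{k_0}<1$ for some index $1\le k_0\le\ell$, then $$\liminf_{N\to\infty}P_N(\beta)=0\qquad\text{and}\qquad\limsup_{N\to\infty}\frac{P_N(\beta)}{N}=\infty.$$
   Context: The Sudler product is $P_N(\beta)=\prod_{r=1}^N|2\sin\pi r\beta|$. An overline denotes the repeated block of a periodic continued fraction. Writing $\beta=[0;d_1,d_2,\ldots]$, the denominators $q_n=q_n(\beta)$ are defined by $q_0=0$, $q_1=1$, $q_{n+1}=d_nq_n+q_{n-1}$. It is known (Grepstad–Neumüller) that the limits $C_k$, $1\le k\le \ell$, exist and are positive. *)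

(* Defs.v *)
From Stdlib Require Import Reals List Arith.
From Coquelicot Require Import Coquelicot.
Open Scope R_scope.

Fixpoint sudler (beta : R) (N : nat) : R :=
  match N with
  | O => 1
  | S N' => sudler beta N' * Rabs (2 * sin (PI * INR N * beta))
  end.

(* Digit sequences are indexed from 1; the value at index 0 is never used. *)

(* [0; x_1, ..., x_n] *)
Fixpoint cfrac_fin (s : list nat) : R :=
  match s with
  | nil => 0
  | x :: s' => / (INR x + cfrac_fin s')
  end.

(* [0; d_1, d_2, ...]; the limit exists whenever all d_n (n >= 1) are positive. *)
Definition cfrac (d : nat -> nat) : R :=
  real (Lim_seq (fun n => cfrac_fin (map d (seq 1 n)))).

(* b_1, ..., b_h followed by a_1, ..., a_l repeated forever. *)
Definition ev_periodic (h l : nat) (b a : nat -> nat) (n : nat) : nat :=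
  if (n <=? h)%nat then b n else a (S ((n - h - 1) mod l)).

(* Shifted indexing: q_0 = 0, q_1 = 1, so that q_{n+1} is the denominator of
   [0; d_1, ..., d_n]. *)
Fixpoint denom (d : nat -> nat) (n : nat) : nat :=
  match n with
  | O => 0
  | S n' =>
      match n' with
      | O => 1
      | S n'' => d n' * denom d n' + denom d n''
      end
  end.

(* Main.v *)
Require Import Defs.
From Stdlib Require Import Reals List Arith ZArith Lia Lra Permutation.
From mathcomp Require all_boot all_algebra Rstruct.
From Coquelicot Require Import Coquelicot.
Open Scope R_scope.

(* Put P_N = P_N(beta) and let q run through the denominators, so that
   ||q beta|| -> 0.

   For fixed N the last N factors of P_{q+N} converge to those of P_N, hence
   P_{q+N} -> C_{k0} P_N along the class of k0.  Iterating, values below any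
   power of a number in (C_{k0}, 1) occur, so liminf P_N = 0.

   Reading the factors of P_{q-1} backwards gives P_{q-1} ~ P_{q-1-N} P_N for
   fixed N.  Choosing P_N small, limsup P_N / N = oo follows from a bound
   P_{q-1} >= const * q, which also replaces the positivity of the limits C_k.

   At the convergent p/q the product equals prod_{s<q} 2 sin(pi s/q) = q.
   Between p/q and beta, at distance <= 1/q^2, the logarithmic derivative is
   pi sum_{r<q} r cot(pi r alpha), so it is enough to bound it by O(q^2), i.e.
   the sums sum_{r<=N} cot(pi r alpha) by O(N) for N < q.  Since beta is badly
   approximable, sum_{r<q_k} 1/sin^2(pi r alpha) = O(q_k^2).  This bounds the
   full sums r < q_k, in which r and q_k - r nearly cancel, and the effect of
   shifting r by q_k, so the largest q_k <= N can be removed from N. *)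

(** * Finite sums *)

Fixpoint sum1 (f : nat -> R) (n : nat) : R :=
  match n with
  | O => 0
  | S n' => sum1 f n' + f n
  end.

Lemma sum1_ext (f g : nat -> R) (n : nat) :
  (forall i, (1 <= i <= n)%nat -> f i = g i) -> sum1 f n = sum1 g n.
Proof.
induction n as [|n IH]; intros H; simpl; [easy|].
rewrite IH, (H (S n)) by (try intros; try apply H; lia); easy.
Qed.

Lemma sum1_le (f g : nat -> R) (n : nat) :
  (forall i, (1 <= i <= n)%nat -> f i <= g i) -> sum1 f n <= sum1 g n.
Proof.
induction n as [|n IH]; intros H; simpl; [lra|].
apply Rplus_le_compat; [apply IH; intros; apply H; lia|apply H; lia].
Qed.

Lemma sum1_ge0 (f : nat -> R) (n : nat) :
  (forall i, (1 <= i <= n)%nat -> 0 <= f i) -> 0 <= sum1 f n.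
Proof.
induction n as [|n IH]; intros H; simpl; [lra|].
apply Rplus_le_le_0_compat; [apply IH; intros; apply H; lia|apply H; lia].
Qed.

Lemma sum1_plus (f g : nat -> R) (n : nat) :
  sum1 (fun i => f i + g i) n = sum1 f n + sum1 g n.
Proof. induction n as [|n IH]; simpl; [|rewrite IH]; ring. Qed.

Lemma sum1_scal (c : R) (f : nat -> R) (n : nat) :
  sum1 (fun i => c * f i) n = c * sum1 f n.
Proof. induction n as [|n IH]; simpl; [|rewrite IH]; ring. Qed.

Lemma sum1_const (c : R) (n : nat) : sum1 (fun _ => c) n = INR n * c.
Proof. induction n as [|n IH]; [simpl; ring|]. rewrite S_INR; simpl; rewrite IH; ring. Qed.

Lemma Rabs_sum1 (f : nat -> R) (n : nat) :
  Rabs (sum1 f n) <= sum1 (fun i => Rabs (f i)) n.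
Proof.
induction n as [|n IH]; simpl; [rewrite Rabs_R0; lra|].
eapply Rle_trans; [apply Rabs_triang|lra].
Qed.

Lemma sum1_add (f : nat -> R) (m n : nat) :
  sum1 f (m + n) = sum1 f m + sum1 (fun i => f (m + i)%nat) n.
Proof.
induction n as [|n IH]; simpl; [rewrite Nat.add_0_r; ring|].
rewrite Nat.add_succ_r; simpl; rewrite IH; ring.
Qed.

Lemma sum1_le_len (f : nat -> R) (m n : nat) :
  (m <= n)%nat -> (forall i, (1 <= i <= n)%nat -> 0 <= f i) ->
  sum1 f m <= sum1 f n.
Proof.
intros Hmn Hf; replace n with (m + (n - m))%nat by lia; rewrite sum1_add.
assert (0 <= sum1 (fun i => f (m + i)%nat) (n - m)); [|lra].
apply sum1_ge0; intros; apply Hf; lia.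
Qed.

Lemma sum1_term (f : nat -> R) (n i : nat) :
  (1 <= i <= n)%nat -> (forall j, (1 <= j <= n)%nat -> 0 <= f j) ->
  f i <= sum1 f n.
Proof.
intros Hi Hf; apply Rle_trans with (sum1 f i).
- destruct i as [|i]; [lia|]; simpl.
  assert (0 <= sum1 f i); [|lra]; apply sum1_ge0; intros; apply Hf; lia.
- apply sum1_le_len; [lia|easy].
Qed.

Lemma sum1_fold (f : nat -> R) (n : nat) :
  sum1 f n = fold_right Rplus 0 (map f (seq 1 n)).
Proof.
induction n as [|n IH]; [easy|].
rewrite seq_S, map_app, fold_right_app; simpl; rewrite IH.
generalize (map f (seq 1 n)); induction l as [|x s IHs]; simpl; [ring|].
rewrite <- IHs; ring.
Qed.

(** An injective self-map of a finite set is a permutation. It is applied to the reflection r -> n +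
    1 - r and to r -> r p mod q. *)
Lemma sum1_perm (f : nat -> R) (s : nat -> nat) (n : nat) :
  (forall i, (1 <= i <= n)%nat -> (1 <= s i <= n)%nat) ->
  (forall i j, (1 <= i <= n)%nat -> (1 <= j <= n)%nat -> s i = s j -> i = j) ->
  sum1 (fun i => f (s i)) n = sum1 f n.
Proof.
intros Hs Hinj; rewrite !sum1_fold.
rewrite <- (map_map s f).
assert (HP : Permutation (map s (seq 1 n)) (seq 1 n)).
{ apply NoDup_Permutation_bis.
  - assert (H : incl (seq 1 n) (seq 1 n)) by apply incl_refl.
    (* The second argument of [incl] stays the full list, so the induction runs over lists whose
       entries are still known to lie in 1, ..., n. *)
    revert H; generalize (seq_NoDup n 1); generalize (seq 1 n) at 1 2 4.
    induction l as [|x u IH]; simpl; intros Hu Hi; [constructor|].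
    inversion Hu as [|? ? Hx Hu']; subst; constructor.
    + rewrite in_map_iff; intros [y [Hy Hyu]]; apply Hx.
      replace x with y; [easy|]; apply Hinj; [| |easy].
      * generalize (Hi y (or_intror Hyu)); rewrite in_seq; lia.
      * generalize (Hi x (or_introl eq_refl)); rewrite in_seq; lia.
    + apply IH; [easy|]; intros y Hy; apply Hi; now right.
  - rewrite length_map; lia.
  - intros y; rewrite in_map_iff; intros [x [<- Hx]].
    apply in_seq in Hx; apply in_seq.
    assert (1 <= s x <= n)%nat by (apply Hs; lia); lia. }
assert (HQ := Permutation_map f HP); revert HQ.
generalize (map f (map s (seq 1 n))) (map f (seq 1 n)).
induction 1; simpl; lra.
Qed.

Lemma sum1_rev (f : nat -> R) (n : nat) :
  sum1 (fun i => f (S n - i)%nat) n = sum1 f n.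
Proof. apply (sum1_perm f (fun i => S n - i)%nat); lia. Qed.

Lemma sum1_inv_sqr (n : nat) : sum1 (fun s => / INR s ^ 2) n <= 2.
Proof.
destruct n as [|n]; [simpl; lra|].
(* The correction 1/n makes the induction telescope, by 1/(x+1)^2 <= 1/x - 1/(x+1). *)
assert (H : sum1 (fun s => / INR s ^ 2) (S n) <= 2 - / INR (S n)).
{ induction n as [|n IH]; [simpl; lra|].
  cbn [sum1] in *; rewrite (S_INR (S n)).
  assert (Hn := pos_INR n); rewrite S_INR in *; set (x := INR n + 1) in *.
  assert (Hx : 1 <= x) by (unfold x; lra).
  assert (/ (x + 1) ^ 2 <= / x - / (x + 1)); [|lra].
  replace (/ x - / (x + 1)) with (/ (x * (x + 1))) by (field; lra).
  apply Rinv_le_contravar; nra. }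
assert (0 < / INR (S n)) by (apply Rinv_0_lt_compat, lt_0_INR; lia).
lra.
Qed.

(** * Sine bounds and the product of sines *)

Lemma sin_PI_add_nat (x : R) (m : nat) :
  Rabs (sin (PI * (x + INR m))) = Rabs (sin (PI * x)).
Proof.
induction m as [|m IH]; [now rewrite Rplus_0_r|].
rewrite S_INR, <- IH.
replace (PI * (x + (INR m + 1))) with (PI * (x + INR m) + PI) by ring.
now rewrite neg_sin, Rabs_Ropp.
Qed.

Lemma sin_PI_sub_nat (x : R) (m : nat) :
  Rabs (sin (PI * (x - INR m))) = Rabs (sin (PI * x)).
Proof. rewrite <- (sin_PI_add_nat (x - INR m) m); do 3 f_equal; ring. Qed.

Lemma Rabs_sin_le (x : R) : Rabs (sin x) <= Rabs x.
Proof.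
assert (H : forall y, 0 <= y -> Rabs (sin y) <= y).
{ intros y Hy; destruct (Req_dec y 0) as [->|Hy0]; [rewrite sin_0, Rabs_R0; lra|].
  assert (sin y < y) by (apply sin_lt_x; lra).
  destruct (Rle_dec y 1) as [H1|H1].
  - rewrite Rabs_pos_eq; [lra|apply sin_ge_0; generalize PI2_1; lra].
  - destruct (SIN_bound y); apply Rabs_le; lra. }
unfold Rabs at 2; destruct (Rcase_abs x) as [Hx|Hx]; [|apply H; lra].
rewrite <- (Rabs_Ropp (sin x)), <- sin_neg; apply H; lra.
Qed.

(** The Taylor bound sin x >= x - x^3/6, with x^2 <= 4. *)
Lemma third_le_sin (x : R) : 0 <= x <= 2 -> x / 3 <= sin x.
Proof.
intros Hx; destruct (pre_sin_bound x 0) as [H _]; [lra|lra|].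
revert H; unfold sin_approx, sin_term; simpl.
intros H; refine (Rle_trans _ _ _ _ H); field_simplify.
assert (x * (x * x) <= x * 4) by (apply Rmult_le_compat_l; nra); nra.
Qed.

(** On [0, 1/2] this follows from [third_le_sin] and pi > 3; the other half is its mirror image. The
    product form treats the zeros at 0 and 1 alike. *)
Lemma sin_PI_ge (y : R) : 0 <= y <= 1 -> y * (1 - y) <= sin (PI * y).
Proof.
assert (HPI := PI2_3_2); assert (H4 := PI_4).
assert (H : forall y, 0 <= y <= 1 / 2 -> y * (1 - y) <= sin (PI * y)).
{ intros z Hz; apply Rle_trans with (PI * z / 3); [nra|].
  apply third_le_sin; nra. }
intros Hy; destruct (Rle_dec y (1 / 2)); [apply H; lra|].
rewrite <- sin_PI_x; replace (PI - PI * y) with (PI * (1 - y)) by ring.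
replace (y * (1 - y)) with ((1 - y) * (1 - (1 - y))) by ring; apply H; lra.
Qed.

Lemma sin_cos_step (x t : R) :
  2 * (cos t * sin ((x + 1) * t)) - sin (x * t) = sin ((x + 1 + 1) * t).
Proof.
replace (x * t) with ((x + 1) * t - t) by ring.
replace ((x + 1 + 1) * t) with ((x + 1) * t + t) by ring.
rewrite sin_plus, sin_minus; ring.
Qed.

(** * Chebyshev polynomials of the second kind and their product formula *)

Module Chebyshev.
Import all_boot all_algebra Rstruct.
Import GRing.Theory.
Local Open Scope ring_scope.

(** The pair U_{n-1}, U_n with U_{-1} = 0; carrying both makes the three-term recurrence
    structurally recursive. *)
Fixpoint chebU_pair (n : nat) : {poly R} * {poly R} :=
  match n with
  | O => (0, 1)
  | S n' => let (u, v) := chebU_pair n' in (v, 2 *: ('X * v) - u)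
  end.

Definition chebU n := (chebU_pair n).2.

Lemma chebUS n : chebU n.+2 = 2 *: ('X * chebU n.+1) - chebU n.
Proof. by rewrite /chebU /=; case: (chebU_pair n) => u v /=. Qed.

Lemma chebU1 : chebU 1 = 2 *: 'X.
Proof. by rewrite /chebU /= mulr1 subr0. Qed.

Lemma size_coef_chebU n : (size (chebU n) <= n.+1)%N /\ (chebU n)`_n = 2 ^+ n.
Proof.
suff : ((size (chebU n) <= n.+1)%N /\ (chebU n)`_n = 2 ^+ n)
  /\ ((size (chebU n.+1) <= n.+2)%N /\ (chebU n.+1)`_n.+1 = 2 ^+ n.+1) by tauto.
elim: n => [|n [[s0 c0] [s1 c1]]].
  rewrite chebU1 /chebU /= size_poly1 coef1 expr0 coefZ coefX expr1 mulr1.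
  do !split => //; by rewrite (leq_trans (size_scale_leq _ _))// size_polyX.
do !split => //; rewrite chebUS.
  apply: leq_trans (size_polyD _ _) _; rewrite geq_max size_polyN.
  apply/andP; split; last by apply: leq_trans s0 _; rewrite ltnW.
  apply: leq_trans (size_scale_leq _ _) _.
  by apply: leq_trans (size_polyMleq _ _) _; rewrite size_polyX.
rewrite coefB coefZ coefXM /= c1 [(chebU n)`__]nth_default ?(leq_trans s0)//.
by rewrite subr0 (exprS _ n.+1).
Qed.

(** The recurrence of [chebU] is the addition formula [sin_cos_step]. The zeros of the right-hand
    side in (0, pi) yield the roots of [chebU n]. *)
Lemma horner_chebU n (t : R) :
  (chebU n).[cos t] * sin t = sin (Rmult (INR n.+1) t).
Proof.
suff : (chebU n).[cos t] * sin t = sin (Rmult (INR n.+1) t) /\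
  (chebU n.+1).[cos t] * sin t = sin (Rmult (INR n.+2) t) by tauto.
have two : (2%:R : R) = IZR 2 by [].
elim: n => [|n [IH0 IH1]].
  rewrite chebU1 /chebU /= !hornerE two -!RmultE.
  split; first reflexivity.
  by rewrite (sin_2a t); ring.
split=> //; rewrite chebUS !hornerE mulrBl IH0 -!mulrA IH1 two.
by rewrite (S_INR n.+2) (S_INR n.+1) -sin_cos_step.
Qed.

(** At t = 0 the previous identity only reads 0 = 0, so the value at 1 is taken from the
    recurrence. *)
Lemma horner_chebU_1 n : (chebU n).[1] = INR n.+1.
Proof.
suff : (chebU n).[1] = INR n.+1 /\ (chebU n.+1).[1] = INR n.+2 by tauto.
have two : (2%:R : R) = IZR 2 by [].
elim: n => [|n [IH0 IH1]]; first by rewrite chebU1 /chebU /= !hornerE.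
split=> //; rewrite chebUS !hornerE IH0 IH1 two.
rewrite (S_INR n.+2) (S_INR n.+1).
change (Rminus (Rmult (Rmult 2 1) (Rplus (INR n.+1) 1)) (INR n.+1)
  = Rplus (Rplus (INR n.+1) 1) 1); ring.
Qed.

(* The roots of [chebU n] are cos (k pi / (n + 1)), its leading coefficient is
   2^n; evaluate at 1. *)
Lemma prod_chebU n :
  List.fold_right Rmult (IZR 1)
    (List.map (fun k => Rmult 2 (Rminus 1 (cos (Rdiv (Rmult (INR k) PI) (INR n.+1)))))
      (List.seq 1 n)) = INR n.+1.
Proof.
set x := fun k => Rdiv (Rmult (INR k) PI) (INR n.+1).
have [szU cU] := size_coef_chebU n.
have two : (2%:R : R) = IZR 2 by [].
have cU0 : (2 ^+ n : R) != 0 by rewrite expf_neq0// Num.Theory.pnatr_eq0.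
have sU : size (chebU n) = n.+1.
  apply/eqP; rewrite eqn_leq szU /= ltnNge; apply/negP => /leq_sizeP /(_ n).
  by rewrite leqnn cU => /(_ isT) /eqP; apply/negP.
pose rs := [seq cos (x k) | k <- iota 1 n].
have xP k : (0 < k <= n)%N -> Rlt 0 (x k) /\ Rlt (x k) PI.
  move=> /andP[k0 kn]; have PI0 := PI_RGT_0.
  have Hk : Rlt 0 (INR k) by apply/lt_0_INR/ltP.
  have Hn : Rlt (INR k) (INR n.+1) by apply/lt_INR/ltP.
  split; first by apply: Rdiv_lt_0_compat; nra.
  apply: (Rmult_lt_reg_r (INR n.+1)); first lra.
  rewrite /x Rdiv_def Rmult_assoc Rinv_l; nra.
have Urs : chebU n = lead_coef (chebU n) *: \prod_(z <- rs) ('X - z%:P).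
  apply: all_roots_prod_XsubC.
  - by rewrite sU size_map size_iota.
  - apply/allP => y /mapP[k]; rewrite mem_iota add1n ltnS => /xP[x0 xpi] ->.
    have := horner_chebU n (x k); rewrite (_ : Rmult _ (x k) = Rmult (INR k) PI).
      rewrite (sin_eq_0_1 (Rmult (INR k) PI)); last by exists (Z.of_nat k); rewrite INR_IZR_INZ.
      case/Rmult_integral => [/eqP //|s0].
      by have := sin_gt_0 _ x0 xpi; rewrite s0 => /Rlt_irrefl.
    rewrite /x; field; apply: not_0_INR; lia.
  - rewrite uniq_rootsE map_inj_in_uniq ?iota_uniq// => i j.
    rewrite !mem_iota !add1n !ltnS => /xP Hi /xP Hj /cos_inj.
    move=> Hc; apply: INR_eq.
    have Hij : x i = x j by apply: Hc; lra.
    have Hn : INR n.+1 <> IZR 0 by apply: not_0_INR.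
    have PI0 := PI_RGT_0.
    apply: (Rmult_eq_reg_r PI); last lra.
    apply: (Rmult_eq_reg_r (Rinv (INR n.+1))); last exact: Rinv_neq_0_compat.
    exact: Hij.
rewrite -[RHS]horner_chebU_1 Urs lead_coefE sU cU.
rewrite hornerZ horner_prod big_map -[n in 2 ^+ n](size_iota 1 n) -[List.seq 1 n]/(iota 1 n).
rewrite {Urs xP rs}/x; elim: (iota 1 n) => [|k s IH]; first by rewrite big_nil expr0 mulr1.
rewrite big_cons /= IH hornerXsubC exprS two.
move: (_ ^+ _) (\prod_(j <- s) _) (cos _) => A B c.
change (Rmult (Rmult 2 (Rminus 1 c)) (Rmult A B)
  = Rmult (Rmult 2 A) (Rmult (Rminus 1 c) B)); ring.
Qed.
End Chebyshev.

Lemma ln_prod (f : nat -> R) (s : list nat) :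
  (forall i, In i s -> 0 < f i) ->
  0 < fold_right Rmult 1 (map f s) /\
  ln (fold_right Rmult 1 (map f s)) = fold_right Rplus 0 (map (fun i => ln (f i)) s).
Proof.
induction s as [|x s IH]; intros H; simpl; [now rewrite ln_1; split; [lra|]|].
destruct IH as [H1 H2]; [intros; apply H; now right|].
assert (H3 := H x (or_introl eq_refl)); split; [now apply Rmult_lt_0_compat|].
now rewrite ln_mult, H2.
Qed.

(** With a_k = 2 sin(pi k / (2q)), [prod_chebU] says that the product of the a_k^2 is q. Pairing k
    with q - k gives a_k a_{q-k} = 2 sin(pi k / q) by the double angle formula, so both products
    agree. *)
Lemma sum_ln_sin (q : nat) :
  (1 <= q)%nat ->
  sum1 (fun s => ln (2 * sin (PI * (INR s / INR q)))) (q - 1) = ln (INR q).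
Proof.
intros Hq; destruct q as [|n]; [lia|]; replace (S n - 1)%nat with n by lia.
assert (HU := f_equal ln (Chebyshev.prod_chebU n)).
assert (Hn : 0 < INR (S n)) by (apply lt_0_INR; lia).
assert (Hsub : forall k, (1 <= k <= n)%nat -> INR (S n - k) = INR (S n) - INR k)
  by (intros; apply minus_INR; lia).
assert (HltS : forall k, (1 <= k <= n)%nat -> INR k < INR (S n))
  by (intros; apply lt_INR; lia).
set (x := INR (S n)) in *.
set (a := fun k : nat => 2 * sin (PI * (INR k / x) / 2)).
assert (Hlt : forall k, (1 <= k <= n)%nat -> 0 < INR k / x < 1).
{ intros k Hk; assert (0 < INR k) by (apply lt_0_INR; lia).
  assert (Hk' := HltS k Hk).
  split; [now apply Rdiv_lt_0_compat|apply Rlt_div_l; lra]. }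
assert (Ha : forall k, (1 <= k <= n)%nat -> 0 < a k).
{ intros k Hk; specialize (Hlt k Hk); unfold a; assert (HPI := PI_RGT_0).
  apply Rmult_lt_0_compat; [lra|]; apply sin_gt_0; nra. }
refine (eq_trans _ HU); clear HU.
rewrite (map_ext_in _ (fun k => a k * a k)).
2:{ intros k _; unfold a.
    replace (INR k * PI / x) with (2 * (PI * (INR k / x) / 2)) by (field; lra).
    rewrite cos_2a_sin; ring. }
destruct (ln_prod (fun k => a k * a k) (seq 1 n)) as [_ ->].
{ intros k Hk; apply in_seq in Hk; apply Rmult_lt_0_compat; apply Ha; lia. }
rewrite <- sum1_fold.
rewrite (sum1_ext _ (fun k => ln (a k) + ln (a (S n - k)%nat))).
- rewrite sum1_plus, (sum1_rev (fun k => ln (a k))), <- sum1_plus.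
  apply sum1_ext; intros k Hk; now rewrite ln_mult by now apply Ha.
- intros k Hk; rewrite <- ln_mult by (apply Ha; lia); f_equal; unfold a.
  rewrite (Hsub k Hk).
  replace (PI * ((x - INR k) / x) / 2)
    with (PI / 2 - PI * (INR k / x) / 2) by (field; lra).
  rewrite sin_shift.
  replace (PI * (INR k / x)) with (2 * (PI * (INR k / x) / 2)) at 1 by (field; lra).
  rewrite sin_2a; ring.
Qed.

(** * Convergents *)

(* Shifted like [denom]: [numer d (S n) / denom d (S n) = [0; d_1, ..., d_n]]. *)
Fixpoint numer (d : nat -> nat) (n : nat) : nat :=
  match n with
  | O => 1
  | S n' =>
      match n' with
      | O => 0
      | S n'' => d n' * numer d n' + numer d n''
      end
  end.

Lemma numerSS (d : nat -> nat) (n : nat) :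
  numer d (S (S n)) = (d (S n) * numer d (S n) + numer d n)%nat.
Proof. reflexivity. Qed.

Lemma denomSS (d : nat -> nat) (n : nat) :
  denom d (S (S n)) = (d (S n) * denom d (S n) + denom d n)%nat.
Proof. reflexivity. Qed.

Lemma numer_denom_det (d : nat -> nat) (n : nat) :
  INR (denom d (S n)) * INR (numer d n) - INR (denom d n) * INR (numer d (S n))
  = (-1) ^ n.
Proof.
induction n as [|n IH]; [simpl; ring|].
rewrite numerSS, denomSS, !plus_INR, !mult_INR; simpl pow; rewrite <- IH; ring.
Qed.

Section Convergents.

Variable d : nat -> nat.
Hypothesis d_ge1 : forall n, (1 <= n)%nat -> (1 <= d n)%nat.

Let p n := INR (numer d n).
Let q n := INR (denom d n).

Lemma denom_ge (n : nat) : (n <= denom d (S n))%nat /\ (1 <= denom d (S n))%nat.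
Proof.
assert (H : (n <= denom d (S n) /\ 1 <= denom d (S n) /\
  S n <= denom d (S (S n)) /\ 1 <= denom d (S (S n)))%nat); [|lia].
induction n as [|n IH].
- assert (H := d_ge1 1 (le_n _)); simpl; lia.
- rewrite (denomSS d (S n)); assert (H := d_ge1 (S (S n))); nia.
Qed.

Lemma q_pos (n : nat) : 0 < q (S n).
Proof. apply lt_0_INR; generalize (denom_ge n); lia. Qed.

Lemma cfrac_fin_bounds (j n : nat) :
  let y := cfrac_fin (map d (seq (S n) j)) in
  0 <= y /\ y * INR (d (S n)) <= 1.
Proof.
revert n; induction j as [|j IH]; intros n; simpl; [lra|].
destruct (IH (S n)) as [H _]; set (z := cfrac_fin _) in *.
assert (1 <= INR (d (S n))) by (apply (le_INR 1), d_ge1; lia).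
split; [left; apply Rinv_0_lt_compat; lra|].
apply Rmult_le_reg_l with (INR (d (S n)) + z); [lra|].
rewrite <- Rmult_assoc, Rinv_r; lra.
Qed.

(** A continued fraction is a Moebius function of its tail [y], with the last two convergents as
    coefficients. For [j] = 0 the tail is 0 and the convergent itself results. *)
Lemma cfrac_fin_tail (j n : nat) :
  let y := cfrac_fin (map d (seq (S n) j)) in
  cfrac_fin (map d (seq 1 (n + j))) = (p (S n) + y * p n) / (q (S n) + y * q n).
Proof.
revert j; induction n as [|n IH]; intros j y.
- unfold p, q; simpl in *; fold y; field.
- replace (S n + j)%nat with (n + S j)%nat by lia; rewrite IH.
  unfold p, q; rewrite numerSS, denomSS, !plus_INR, !mult_INR.
  fold (p n) (p (S n)) (q n) (q (S n)).
  cbn [seq map cfrac_fin]; fold y.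
  destruct (cfrac_fin_bounds j (S n)) as [Hy _]; fold y in Hy.
  assert (1 <= INR (d (S n))) by (apply (le_INR 1), d_ge1; lia).
  assert (Hq := q_pos n); assert (0 <= q n) by apply pos_INR.
  field; split; nra.
Qed.

(** By the determinant identity the error is y / (q_{n+1} + y q_n) up to sign, and y d_{n+1} <= 1.
    Stated for finite fractions, it serves both the later convergents and, in the limit,
    [cfrac d]. *)
Lemma convergent_dist (n j : nat) :
  Rabs (q (S n) * cfrac_fin (map d (seq 1 (n + j))) - p (S n)) <= / q (S (S n)).
Proof.
rewrite cfrac_fin_tail; set (y := cfrac_fin _).
destruct (cfrac_fin_bounds j n) as [Hy Hy']; fold y in Hy, Hy'.
assert (Hq := q_pos n); assert (Hq' := q_pos (S n)).
assert (Hq0 : 0 <= q n) by apply pos_INR.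
assert (HD : 0 < q (S n) + y * q n) by nra.
replace (q (S n) * ((p (S n) + y * p n) / (q (S n) + y * q n)) - p (S n))
  with (y / (q (S n) + y * q n) * (q (S n) * p n - q n * p (S n))) by (field; lra).
unfold p at 1 2, q at 3 4; rewrite numer_denom_det, Rabs_mult, pow_1_abs, Rmult_1_r.
rewrite Rabs_pos_eq by (apply Rdiv_le_0_compat; lra).
apply Rle_div_l; [lra|].
apply Rmult_le_reg_l with (q (S (S n))); [lra|].
rewrite <- Rmult_assoc, Rinv_r by lra.
assert (q (S (S n)) = INR (d (S n)) * q (S n) + q n) as ->; [|nra].
unfold q; rewrite denomSS, plus_INR, mult_INR; ring.
Qed.

Lemma cfrac_fin_cv : is_lim_seq (fun n => cfrac_fin (map d (seq 1 n))) (cfrac d).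
Proof.
apply Lim_seq_correct', ex_lim_seq_cauchy_corr; intros eps.
(* All fractions of length at least N lie within 1/N < eps/2 of the same convergent, hence within
   eps of each other. *)
destruct (archimed_cor1 (eps / 2)) as [N [HN HN0]]; [generalize (cond_pos eps); lra|].
assert (H : forall j, Rabs (cfrac_fin (map d (seq 1 (N + j))) - p (S N) / q (S N)) <= / INR N).
{ intros j; assert (Hd := convergent_dist N j).
  set (x := cfrac_fin _) in *; assert (Hq := q_pos N).
  assert (HqN : INR N <= q (S N)) by (apply le_INR, denom_ge).
  assert (Hq1 : 1 <= q (S (S N))) by (apply (le_INR 1), denom_ge).
  assert (0 < INR N) by (apply lt_0_INR; lia).
  replace (x - p (S N) / q (S N)) with (/ q (S N) * (q (S N) * x - p (S N))) by (field; lra).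
  rewrite Rabs_mult, Rabs_pos_eq by (left; apply Rinv_0_lt_compat; lra).
  assert (/ q (S (S N)) <= 1) by (rewrite <- Rinv_1; apply Rinv_le_contravar; lra).
  assert (/ q (S N) <= / INR N) by (apply Rinv_le_contravar; lra).
  assert (0 < / q (S N)) by (apply Rinv_0_lt_compat; lra); nra. }
exists N; intros m m' Hm Hm'.
assert (H1 := H (m - N)%nat); assert (H2 := H (m' - N)%nat).
replace (N + (m - N))%nat with m in H1 by lia.
replace (N + (m' - N))%nat with m' in H2 by lia.
apply Rabs_le_between' in H1; apply Rabs_le_between' in H2.
apply Rabs_lt_between'; lra.
Qed.

Lemma cfrac_dist (n : nat) :
  Rabs (q (S n) * cfrac d - p (S n)) <= / q (S (S n)).
Proof.
assert (H : is_lim_seq (fun j => Rabs (q (S n) * cfrac_fin (map d (seq 1 (j + n))) - p (S n)))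
  (Rabs (q (S n) * cfrac d - p (S n)))).
{ apply (is_lim_seq_continuous (fun x => Rabs (q (S n) * x - p (S n)))).
  - apply continuity_pt_filterlim.
    apply (continuous_comp (fun x => q (S n) * x - p (S n)) Rabs); [|apply continuous_Rabs].
    apply (ex_derive_continuous (fun x => q (S n) * x - p (S n))); auto_derive; easy.
  - apply (is_lim_seq_incr_n (fun j => cfrac_fin (map d (seq 1 j))) n), cfrac_fin_cv. }
refine (is_lim_seq_le _ _ _ _ _ H (is_lim_seq_const _)).
intros j; rewrite Nat.add_comm; apply convergent_dist.
Qed.

(** * Coprimality and residues modulo a denominator *)

Lemma numer_denom_coprime (n : nat) : Nat.gcd (denom d (S n)) (numer d (S n)) = 1%nat.
Proof.
(* A common divisor divides this determinant, which is 1 or -1. *)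
assert (H : Z.abs (Z.of_nat (denom d (S n)) * Z.of_nat (numer d n) -
  Z.of_nat (denom d n) * Z.of_nat (numer d (S n))) = 1%Z).
{ assert (Hd := numer_denom_det d n).
  rewrite !INR_IZR_INZ, <- !mult_IZR, <- minus_IZR in Hd.
  apply eq_IZR; rewrite abs_IZR, Hd; apply pow_1_abs. }
destruct (Nat.gcd_divide (denom d (S n)) (numer d (S n))) as [[u Hu] [v Hv]].
set (g := Nat.gcd _ _) in *; clearbody g.
rewrite Hu, Hv, !Nat2Z.inj_mul in H.
assert (Hg : (Z.abs (Z.of_nat g) *
  Z.abs (Z.of_nat u * Z.of_nat (numer d n) - Z.of_nat (denom d n) * Z.of_nat v) = 1)%Z).
{ rewrite <- Z.abs_mul, <- H; f_equal; ring. }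
apply Z.eq_mul_1_nonneg in Hg; lia.
Qed.

Lemma denom_le_S (n : nat) : (denom d n <= denom d (S n))%nat.
Proof.
destruct n as [|n]; [simpl; lia|]; rewrite denomSS.
assert (H := d_ge1 (S n)); nia.
Qed.

(** With s this residue, r p/q and s/q differ by an integer. Since r -> s permutes 1, ..., q - 1,
    sums over the points r p/q modulo 1 become sums over s/q. *)
Definition residue (n r : nat) : nat := (r * numer d (S n)) mod denom d (S n).

Lemma denom_ndivide_mul_numer (n r : nat) :
  (1 <= r < denom d (S n))%nat -> ~ Nat.divide (denom d (S n)) (r * numer d (S n)).
Proof.
intros Hr H; rewrite Nat.mul_comm in H.
apply Nat.gauss in H; [|apply numer_denom_coprime].
apply Nat.divide_pos_le in H; lia.
Qed.

Lemma residue_range (n r : nat) :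
  (1 <= r <= denom d (S n) - 1)%nat -> (1 <= residue n r <= denom d (S n) - 1)%nat.
Proof.
intros Hr; unfold residue.
assert (H := Nat.mod_upper_bound (r * numer d (S n)) (denom d (S n))).
assert ((r * numer d (S n)) mod denom d (S n) <> 0)%nat; [|lia].
intros H0; apply (denom_ndivide_mul_numer n r); [lia|].
now apply Nat.Lcm0.mod_divide.
Qed.

Lemma residue_inj (n r r' : nat) :
  (1 <= r <= denom d (S n) - 1)%nat -> (1 <= r' <= denom d (S n) - 1)%nat ->
  residue n r = residue n r' -> r = r'.
Proof.
assert (H : forall r r', (1 <= r)%nat -> (r < r' <= denom d (S n) - 1)%nat ->
  residue n r <> residue n r').
{ clear r r'; intros r r' Hr Hr' H; apply (denom_ndivide_mul_numer n (r' - r)); [lia|].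
  unfold residue in H.
  assert (H1 := Nat.div_mod (r * numer d (S n)) (denom d (S n))).
  assert (H2 := Nat.div_mod (r' * numer d (S n)) (denom d (S n))).
  exists ((r' * numer d (S n)) / denom d (S n) - (r * numer d (S n)) / denom d (S n))%nat.
  rewrite !Nat.mul_sub_distr_r; lia. }
intros Hr Hr' E; destruct (Nat.lt_trichotomy r r') as [L|[L|L]]; [|easy|].
- exfalso; apply (H r r'); [lia|lia|easy].
- exfalso; apply (H r' r); [lia|lia|easy].
Qed.

(** * Sine estimates for bounded digits *)

Variable B : R.
Hypothesis d_leB : forall n, (1 <= n)%nat -> INR (d n) <= B.

Lemma B_ge1 : 1 <= B.
Proof. apply Rle_trans with (INR (d 1)); [apply (le_INR 1), d_ge1; lia|apply d_leB; lia]. Qed.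

Lemma q_le_S (n : nat) : q n <= q (S n).
Proof. apply le_INR, denom_le_S. Qed.

Lemma q_SS_le (n : nat) : q (S (S n)) <= (B + 1) * q (S n).
Proof.
unfold q at 1; rewrite denomSS, plus_INR, mult_INR; fold (q n) (q (S n)).
assert (H1 := q_le_S n); assert (H2 := d_leB (S n)); assert (H3 := q_pos n).
assert (INR (d (S n)) * q (S n) <= B * q (S n)) by (apply Rmult_le_compat_r; [lra|apply H2; lia]).
lra.
Qed.

Let kappa := / (B + 1) ^ 2.

Lemma kappa_bounds : 0 < kappa <= 1.
Proof.
assert (H := B_ge1); unfold kappa; split; [apply Rinv_0_lt_compat; nra|].
rewrite <- Rinv_1; apply Rinv_le_contravar; nra.
Qed.

(** Two steps multiply the denominator by at most (B+1)^2, so q_{n+1} >= kappa q_{n+3}; with q_{n+3}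
    >= q_{n+2} + q_{n+1} this gives q_{n+2} <= (1 - kappa) q_{n+3}. The factor 1 - kappa is the room
    that [sin_lower] needs. *)
Lemma inv_q_le (n : nat) : / q (S (S (S n))) <= (1 - kappa) / q (S (S n)).
Proof.
assert (H0 := B_ge1); assert (H1 := q_SS_le n); assert (H2 := q_SS_le (S n)).
assert (H3 := q_pos n); assert (H4 := q_pos (S n)); assert (H5 := q_pos (S (S n))).
assert (H6 : q (S (S n)) + q (S n) <= q (S (S (S n)))).
{ unfold q; rewrite <- plus_INR; apply le_INR; rewrite (denomSS d (S n)).
  assert (H := d_ge1 (S (S n))); nia. }
assert (H7 : kappa * q (S (S (S n))) <= q (S n)).
{ unfold kappa; apply Rmult_le_reg_l with ((B + 1) ^ 2); [nra|].
  rewrite <- Rmult_assoc, Rinv_r; nra. }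
apply Rmult_le_reg_l with (q (S (S (S n)))); [lra|]; rewrite Rinv_r by lra.
apply Rmult_le_reg_r with (q (S (S n))); [lra|].
replace (q (S (S (S n))) * ((1 - kappa) / q (S (S n))) * q (S (S n)))
  with ((1 - kappa) * q (S (S (S n)))) by (field; lra).
lra.
Qed.

(** Modulo 1, r al = u + th with |th| <= (1 - kappa)/q, while u has distance at least 1/q from 0 and
    1. So the perturbation leaves at least the fraction kappa of both distances, and [sin_PI_ge]
    multiplies the two. *)
Lemma sin_lower (n r : nat) (al : R) :
  Rabs (q (S n) * al - p (S n)) <= / q (S (S n)) ->
  (1 <= r <= denom d (S n) - 1)%nat ->
  let u := INR (residue n r) / q (S n) in
  0 < u < 1 /\ kappa ^ 2 * (u * (1 - u)) <= Rabs (sin (PI * (INR r * al))).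
Proof.
(* For [n] = 0 the denominator is 1 and there is no r. *)
intros Hal Hr u; destruct n as [|n]; [simpl in Hr; lia|].
assert (Hk := kappa_bounds); assert (Hs := residue_range _ _ Hr).
assert (Hq := q_pos (S n)); assert (Hi := inv_q_le n).
set (s := residue (S n) r) in *.
assert (Hs1 : 1 <= INR s) by (apply (le_INR 1); lia).
assert (Hs2 : INR s <= q (S (S n)) - 1).
{ change 1 with (INR 1); unfold q; rewrite <- minus_INR by lia; apply le_INR; lia. }
assert (Hr1 : 0 <= INR r <= q (S (S n))).
{ split; [apply pos_INR|apply le_INR; lia]. }
set (Q := q (S (S n))) in *.
assert (HuQ : u * Q = INR s) by (unfold u; field; lra).
assert (Hu : 0 < u < 1) by (split; nra).
split; [easy|].
set (th := INR r / Q * (Q * al - p (S (S n)))).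
assert (Hth : Rabs th <= (1 - kappa) / Q).
{ unfold th; rewrite Rabs_mult, Rabs_pos_eq by (apply Rdiv_le_0_compat; lra).
  assert (0 <= INR r / Q <= 1).
  { split; [apply Rdiv_le_0_compat; lra|apply Rle_div_l; lra]. }
  assert (Hp := Rabs_pos (Q * al - p (S (S n)))); nra. }
assert (HthQ : Rabs th * Q <= 1 - kappa).
{ apply Rle_div_r in Hth; lra. }
apply Rabs_le_between in Hth.
set (m := ((r * numer d (S (S n))) / denom d (S (S n)))%nat).
assert (Hm : INR r * p (S (S n)) = Q * INR m + INR s).
{ unfold p, Q, q; rewrite <- !mult_INR, <- plus_INR; f_equal.
  apply Nat.div_mod; lia. }
replace (INR r * al) with (u + th + INR m).
2:{ unfold th, u; apply Rmult_eq_reg_l with Q; [|lra].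
    replace (INR s) with (INR r * p (S (S n)) - Q * INR m) by lra; field; lra. }
rewrite sin_PI_add_nat.
assert (Hy1 : kappa * u <= u + th).
{ apply Rmult_le_reg_r with Q; [lra|].
  assert (- (1 - kappa) / Q * Q = - (1 - kappa)) by (field; lra).
  assert (- ((1 - kappa) / Q) = - (1 - kappa) / Q) by (field; lra). nra. }
assert (Hy2 : kappa * (1 - u) <= 1 - (u + th)).
{ apply Rmult_le_reg_r with Q; [lra|].
  assert ((1 - kappa) / Q * Q = (1 - kappa)) by (field; lra). nra. }
eapply Rle_trans; [|apply Rle_abs].
eapply Rle_trans; [|apply sin_PI_ge; split; nra].
replace (kappa ^ 2 * (u * (1 - u))) with ((kappa * u) * (kappa * (1 - u))) by ring.
apply Rmult_le_compat; nra.
Qed.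

(** By [sin_lower] and 1/(u(1-u)) = 1/u + 1/(1-u), the sum is compared with sums of 1/s^2 over the
    permuted residues s and their reflections q - s. The constant is kappa^(-4) = (B+1)^8, times 2
    from squaring a sum, times 2 + 2 from [sum1_inv_sqr]. *)
Lemma sum_inv_sin_sqr (n : nat) (al : R) :
  Rabs (q (S n) * al - p (S n)) <= / q (S (S n)) ->
  sum1 (fun r => / sin (PI * (INR r * al)) ^ 2) (denom d (S n) - 1)
  <= 8 * (B + 1) ^ 8 * q (S n) ^ 2.
Proof.
intros Hal; set (N := (denom d (S n) - 1)%nat).
assert (HN : q (S n) = INR N + 1).
{ rewrite <- S_INR; unfold q, N; f_equal; assert (H := denom_ge n); lia. }
set (h := fun s => / INR s ^ 2 + / INR (S N - s) ^ 2).
apply Rle_trans with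
  (sum1 (fun r => 2 * (B + 1) ^ 8 * q (S n) ^ 2 * h (residue n r)) N).
- apply sum1_le; intros r Hr; destruct (sin_lower n r al Hal Hr) as [Hu Hs].
  assert (HB := B_ge1); assert (Hk := kappa_bounds).
  assert (Hsr := residue_range n r Hr); fold N in Hsr.
  unfold h; rewrite minus_INR, S_INR, <- HN by lia.
  assert (Hq := q_pos n); set (Q := q (S n)) in *.
  replace (INR (residue n r)) with (INR (residue n r) / Q * Q) by (field; lra).
  set (u := INR (residue n r) / Q) in *.
  rewrite <- pow2_abs.
  assert (0 < kappa ^ 2 * (u * (1 - u))).
  { apply Rmult_lt_0_compat; [apply pow_lt; lra|nra]. }
  apply Rle_trans with (/ (kappa ^ 2 * (u * (1 - u))) ^ 2).
  { apply Rinv_le_contravar.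
    - now apply pow_lt.
    - apply pow_incr; split; [lra|easy]. }
  replace (/ (kappa ^ 2 * (u * (1 - u))) ^ 2) with ((B + 1) ^ 8 * (/ u + / (1 - u)) ^ 2)
    by (unfold kappa; field; lra).
  replace (2 * (B + 1) ^ 8 * Q ^ 2 * (/ (u * Q) ^ 2 + / (Q - u * Q) ^ 2))
    with ((B + 1) ^ 8 * (2 * (/ u) ^ 2 + 2 * (/ (1 - u)) ^ 2)) by (field; split; nra).
  apply Rmult_le_compat_l; [apply pow_le; lra|].
  assert (Hsq := pow2_ge_0 (/ u - / (1 - u))); nra.
- rewrite sum1_scal, (sum1_perm h (residue n));
    [|apply residue_range|apply residue_inj].
  unfold h; rewrite sum1_plus, (sum1_rev (fun s => / INR s ^ 2)).
  assert (H := sum1_inv_sqr N); assert (HB := B_ge1).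
  replace (8 * (B + 1) ^ 8 * q (S n) ^ 2)
    with (2 * (B + 1) ^ 8 * q (S n) ^ 2 * (2 + 2)) by ring.
  apply Rmult_le_compat_l; [|lra].
  apply Rmult_le_pos; [|apply pow2_ge_0].
  apply Rmult_le_pos; [lra|apply pow_le; lra].
Qed.
End Convergents.

(** * Cotangent sums *)

Definition cot (x : R) : R := cos x / sin x.

Lemma Rabs_inv_mul_le (a b : R) :
  a <> 0 -> b <> 0 -> Rabs (/ (a * b)) <= (/ a ^ 2 + / b ^ 2) / 2.
Proof.
intros Ha Hb; rewrite <- !pow_inv, Rinv_mult; set (x := / a); set (y := / b).
assert (H1 := pow2_ge_0 (x - y)); assert (H2 := pow2_ge_0 (x + y)).
apply Rabs_le; lra.
Qed.

(** The sum of cotangents is sin(x+y)/(sin x sin y), small when x + y is near a multiple of pi; the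
    denominator is split by the inequality of means. *)
Lemma cot_plus_le (x y : R) : sin x <> 0 -> sin y <> 0 ->
  Rabs (cot x + cot y) <= Rabs (sin (x + y)) * ((/ sin x ^ 2 + / sin y ^ 2) / 2).
Proof.
intros Hx Hy; unfold cot.
replace (cos x / sin x + cos y / sin y) with (sin (x + y) * / (sin x * sin y))
  by (rewrite sin_plus; field; easy).
rewrite Rabs_mult; apply Rmult_le_compat_l; [apply Rabs_pos|now apply Rabs_inv_mul_le].
Qed.

Lemma cot_opp (x : R) : cot (- x) = - cot x.
Proof. unfold cot; rewrite sin_neg, cos_neg; unfold Rdiv; rewrite Rinv_opp; ring. Qed.

Lemma cot_minus_le (x y : R) : sin x <> 0 -> sin y <> 0 ->
  Rabs (cot x - cot y) <= Rabs (sin (x - y)) * ((/ sin x ^ 2 + / sin y ^ 2) / 2).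
Proof.
intros Hx Hy; unfold Rminus; rewrite <- cot_opp.
replace (/ sin y ^ 2) with (/ sin (- y) ^ 2) by (rewrite sin_neg; f_equal; ring).
apply cot_plus_le; [easy|rewrite sin_neg; lra].
Qed.

Lemma abel_sum1 (c : nat -> R) (n : nat) :
  sum1 (fun r => INR r * c r) n =
  INR n * sum1 c n - sum1 (fun r => sum1 c (r - 1)) n.
Proof.
induction n as [|n IH]; [simpl; ring|].
cbn [sum1]; rewrite IH, S_INR, Nat.sub_succ, Nat.sub_0_r; ring.
Qed.

Section CotangentSums.

(** To be instantiated with the denominators [denom d (S k)], [A] = B + 1, and for [E] the constant
    of [sum_inv_sin_sqr]. *)
Variables (Q : nat -> nat) (al A E : R) (n : nat).
Let w (r : nat) : R := / sin (PI * (INR r * al)) ^ 2.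
Let c (r : nat) : R := cot (PI * (INR r * al)).

Hypothesis Q_0 : Q 0 = 1%nat.
Hypothesis Q_le_S : forall k, (Q k <= Q (S k))%nat.
Hypothesis Q_S_le : forall k, INR (Q (S k)) <= A * INR (Q k).
Hypothesis A_ge1 : 1 <= A.
Hypothesis E_ge1 : 1 <= E.
Hypothesis sin_Q : forall k, (k <= n)%nat ->
  Rabs (sin (PI * (INR (Q k) * al))) <= 4 / INR (Q (S k)).
Hypothesis sum_w : forall k, (k <= n)%nat -> sum1 w (Q k - 1) <= E * INR (Q k) ^ 2.
Hypothesis sin_neq0 : forall r, (1 <= r < Q n)%nat -> sin (PI * (INR r * al)) <> 0.

Lemma Q_mono (i j : nat) : (i <= j)%nat -> (Q i <= Q j)%nat.
Proof. induction 1 as [|j _ IH]; [easy|]; assert (H := Q_le_S j); lia. Qed.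

Lemma INR_Q_ge1 (k : nat) : 1 <= INR (Q k).
Proof. apply (le_INR 1); rewrite <- Q_0; apply Q_mono; lia. Qed.

Lemma w_ge0 (k r : nat) : (k <= n)%nat -> (1 <= r <= Q k - 1)%nat -> 0 <= w r.
Proof.
intros Hk Hr; assert (H := Q_mono k n Hk).
left; apply Rinv_0_lt_compat, pow2_gt_0, sin_neq0; lia.
Qed.

(* The reflection r -> Q k - r nearly changes the sign of the cotangent. *)
Lemma full_cot_sum (k : nat) :
  (k <= n)%nat -> Rabs (sum1 c (Q k - 1)) <= 4 * E * INR (Q k).
Proof.
intros Hk; assert (H1 := INR_Q_ge1 k); assert (H2 := INR_Q_ge1 (S k)).
assert (HQn := Q_mono k n Hk); assert (Hw := sum_w k Hk).
assert (Hrev : forall f, sum1 (fun r => f (Q k - r)%nat) (Q k - 1) = sum1 f (Q k - 1)).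
{ intros f; rewrite <- (sum1_rev f); apply sum1_ext; intros r Hr; f_equal; lia. }
assert (Hle : Rabs (2 * sum1 c (Q k - 1)) <= 4 / INR (Q (S k)) * sum1 w (Q k - 1)).
{ replace (2 * sum1 c (Q k - 1)) with (sum1 (fun r => c r + c (Q k - r)%nat) (Q k - 1))
    by (rewrite sum1_plus, Hrev; ring).
  replace (4 / INR (Q (S k)) * sum1 w (Q k - 1))
    with (sum1 (fun r => 4 / INR (Q (S k)) / 2 * (w r + w (Q k - r)%nat)) (Q k - 1))
    by (rewrite sum1_scal, sum1_plus, Hrev; field; lra).
  eapply Rle_trans; [apply Rabs_sum1|]; apply sum1_le; intros r Hr.
  eapply Rle_trans; [apply cot_plus_le; apply sin_neq0; lia|].
  fold (w r) (w (Q k - r)%nat); rewrite minus_INR by lia.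
  replace (PI * (INR r * al) + PI * ((INR (Q k) - INR r) * al))
    with (PI * (INR (Q k) * al)) by ring.
  assert (Hs := sin_Q k Hk).
  assert (0 <= w r) by (apply (w_ge0 k); [easy|lia]).
  assert (0 <= w (Q k - r)%nat) by (apply (w_ge0 k); [easy|lia]).
  replace (4 / INR (Q (S k)) / 2 * (w r + w (Q k - r)%nat))
    with (4 / INR (Q (S k)) * ((w r + w (Q k - r)%nat) / 2)) by (field; lra).
  apply Rmult_le_compat_r; lra. }
rewrite Rabs_mult, (Rabs_pos_eq 2) in Hle by lra.
assert (H3 : INR (Q k) <= INR (Q (S k))) by apply le_INR, Q_le_S.
assert (4 / INR (Q (S k)) * sum1 w (Q k - 1) <= 4 * E * INR (Q k));
  [|assert (0 <= E * INR (Q k)) by nra; lra].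
unfold Rdiv; rewrite (Rmult_comm 4), Rmult_assoc.
apply Rmult_le_reg_l with (INR (Q (S k))); [lra|].
rewrite <- Rmult_assoc, Rinv_r, Rmult_1_l by lra.
apply Rle_trans with (4 * (E * INR (Q k) ^ 2)); [lra|].
replace (INR (Q (S k)) * (4 * E * INR (Q k))) with (4 * E * INR (Q k) * INR (Q (S k))) by ring.
replace (4 * (E * INR (Q k) ^ 2)) with (4 * E * INR (Q k) * INR (Q k)) by ring.
apply Rmult_le_compat_l; [nra|easy].
Qed.

(** Each difference is at most 4/Q_{k+1} times a mean of two values of [w]. All indices stay in 1,
    ..., Q_{k+1} - 1, so either sum of [w] is at most E Q_{k+1}^2. *)
Lemma cot_shift_sum (k N : nat) :
  (S k <= n)%nat -> (Q k + N < Q (S k))%nat ->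
  Rabs (sum1 (fun r => c (Q k + r)%nat - c r) N) <= 4 * E * INR (Q (S k)).
Proof.
intros Hk HN; assert (HQn := Q_mono (S k) n Hk); assert (H2 := INR_Q_ge1 (S k)).
assert (Hw := sum_w (S k) Hk).
assert (Hw0 : forall i, (1 <= i <= Q (S k) - 1)%nat -> 0 <= w i)
  by (intros; now apply (w_ge0 (S k))).
apply Rle_trans with (sum1 (fun r => 4 / INR (Q (S k)) / 2 * (w (Q k + r)%nat + w r)) N).
{ eapply Rle_trans; [apply Rabs_sum1|]; apply sum1_le; intros r Hr.
  eapply Rle_trans; [apply cot_minus_le; apply sin_neq0; lia|].
  fold (w r) (w (Q k + r)%nat); rewrite plus_INR.
  replace (PI * ((INR (Q k) + INR r) * al) - PI * (INR r * al))
    with (PI * (INR (Q k) * al)) by ring.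
  assert (Hs := sin_Q k (Nat.lt_le_incl _ _ Hk)).
  assert (0 <= w r) by (apply Hw0; lia).
  assert (0 <= w (Q k + r)%nat) by (apply Hw0; lia).
  replace (4 / INR (Q (S k)) / 2 * (w (Q k + r)%nat + w r))
    with (4 / INR (Q (S k)) * ((w (Q k + r)%nat + w r) / 2)) by (field; lra).
  apply Rmult_le_compat_r; lra. }
rewrite sum1_scal, sum1_plus.
assert (sum1 w N <= sum1 w (Q (S k) - 1)) by (apply sum1_le_len; [lia|easy]).
assert (sum1 (fun r => w (Q k + r)%nat) N <= sum1 w (Q (S k) - 1)).
{ apply Rle_trans with (sum1 w (Q k + N)); [|apply sum1_le_len; [lia|easy]].
  rewrite sum1_add; assert (0 <= sum1 w (Q k)); [|lra].
  apply sum1_ge0; intros; apply Hw0; lia. }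
apply Rle_trans with (4 / INR (Q (S k)) / 2 * (2 * (E * INR (Q (S k)) ^ 2))).
- apply Rmult_le_compat_l; [|lra]; repeat apply Rdiv_le_0_compat; lra.
- right; field; lra.
Qed.

(** Here cot^2 <= [w], and [w] is a single term of a sum at most E Q_{k+1}^2 <= (E Q_{k+1})^2, as E
    >= 1. *)
Lemma cot_Q_le (k : nat) :
  (S k <= n)%nat -> (Q k < Q (S k))%nat -> Rabs (c (Q k)) <= E * INR (Q (S k)).
Proof.
intros Hk HQ; assert (HQn := Q_mono (S k) n Hk); assert (H2 := INR_Q_ge1 (S k)).
assert (HQ0 := Q_mono 0 k (Nat.le_0_l k)).
assert (Hw : w (Q k) <= (E * INR (Q (S k))) ^ 2).
{ apply Rle_trans with (sum1 w (Q (S k) - 1)).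
  - apply sum1_term; [lia|]; intros; now apply (w_ge0 (S k)).
  - eapply Rle_trans; [now apply sum_w|]; rewrite Rpow_mult_distr.
    apply Rmult_le_compat_r; [apply pow2_ge_0|]; nra. }
assert (Hc : c (Q k) ^ 2 <= w (Q k)).
{ assert (Hs : sin (PI * (INR (Q k) * al)) <> 0) by (apply sin_neq0; lia).
  unfold c, w, cot; set (x := PI * _) in *; rewrite <- pow_inv; unfold Rdiv.
  rewrite Rpow_mult_distr; assert (H := sin2_cos2 x); unfold Rsqr in H.
  assert (H' := pow2_ge_0 (/ sin x)).
  assert (cos x ^ 2 <= 1) by nra; nra. }
apply Rsqr_incr_0; [|apply Rabs_pos|nra].
rewrite <- Rsqr_abs; unfold Rsqr; lra.
Qed.

(** Removing the largest Q_k <= N from N costs 4E Q_k for the full sum, E Q_{k+1} for the term at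
    Q_k and 4E Q_{k+1} for the shift. With Q_{k+1} <= A Q_k this is proportional to the amount Q_k
    removed, so the costs add up to a multiple of N. *)
Lemma cot_sum_le (N : nat) :
  (N < Q n)%nat -> Rabs (sum1 c N) <= (4 * E + 5 * E * A) * INR N.
Proof.
induction N as [N IH] using lt_wf_ind; intros HN.
destruct (Nat.eq_dec N 0) as [->|HN0]; [simpl; rewrite Rabs_R0; lra|].
assert (Hk : exists k, (S k <= n)%nat /\ (Q k <= N < Q (S k))%nat).
{ clear IH; assert (H : forall j, (j <= n)%nat -> (N < Q j)%nat ->
    exists k, (S k <= j)%nat /\ (Q k <= N < Q (S k))%nat).
  { induction j as [|j IHj]; intros Hj HNj; [lia|].
    destruct (le_lt_dec (Q j) N) as [L|L]; [exists j; lia|].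
    destruct IHj as [k Hk]; [lia|easy|exists k; lia]. }
  destruct (H n (le_n _) HN) as [k Hk]; now exists k. }
destruct Hk as [k [Hk HkN]]; assert (HQ1 := INR_Q_ge1 k).
assert (HQ0 := Q_mono 0 k (Nat.le_0_l k)).
set (M := (N - Q k)%nat).
assert (Hsum : sum1 c N = sum1 c (Q k - 1) + c (Q k)
  + sum1 (fun r => c (Q k + r)%nat - c r) M + sum1 c M).
{ replace N with (Q k + M)%nat by lia; rewrite sum1_add.
  replace (sum1 c (Q k)) with (sum1 c (Q k - 1) + c (Q k)).
  2:{ replace (Q k) with (S (Q k - 1)) at 2 3 by lia; reflexivity. }
  rewrite Rplus_assoc, (Rplus_assoc (_ + _)), <- sum1_plus, <- Rplus_assoc; f_equal.
  apply sum1_ext; intros; ring. }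
assert (H1 := full_cot_sum k (Nat.lt_le_incl _ _ Hk)).
assert (H2 := cot_Q_le k Hk ltac:(lia)).
assert (H3 := cot_shift_sum k M Hk ltac:(lia)).
assert (H4 := IH M ltac:(lia) ltac:(lia)).
assert (H5 : INR N = INR (Q k) + INR M) by (rewrite <- plus_INR; f_equal; lia).
assert (H6 : E * INR (Q (S k)) <= E * (A * INR (Q k))).
{ apply Rmult_le_compat_l; [lra|apply Q_S_le]. }
rewrite Hsum, H5.
apply Rabs_le_between in H1; apply Rabs_le_between in H2.
apply Rabs_le_between in H3; apply Rabs_le_between in H4.
apply Rabs_le; split; nra.
Qed.

(** Abel summation leaves two terms, each at most Q_n times the largest partial sum; hence the
    factor 2. *)
Lemma weighted_cot_sum_le :
  Rabs (sum1 (fun r => INR r * c r) (Q n - 1)) <=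
  2 * (4 * E + 5 * E * A) * INR (Q n) ^ 2.
Proof.
assert (HQ := INR_Q_ge1 n); set (D := 4 * E + 5 * E * A).
assert (HD : 0 <= D) by (unfold D; nra).
assert (HQ' : INR (Q n - 1) = INR (Q n) - 1).
{ rewrite minus_INR by (apply INR_le; simpl; lra); reflexivity. }
assert (HQn : (1 <= Q n)%nat) by (apply INR_le; simpl; lra).
assert (H0 : forall N, (N < Q n)%nat -> Rabs (sum1 c N) <= D * INR (Q n)).
{ intros N HN; eapply Rle_trans; [now apply cot_sum_le|].
  apply Rmult_le_compat_l; [easy|apply le_INR; lia]. }
rewrite abel_sum1; eapply Rle_trans; [apply Rabs_triang|]; rewrite Rabs_Ropp.
apply Rle_trans with (INR (Q n) * (D * INR (Q n)) + INR (Q n) * (D * INR (Q n))); [|right; ring].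
assert (HDQ : 0 <= D * INR (Q n)) by nra.
apply Rplus_le_compat.
- rewrite Rabs_mult, Rabs_pos_eq by apply pos_INR.
  apply Rmult_le_compat; [apply pos_INR|apply Rabs_pos|lra|apply H0; lia].
- eapply Rle_trans; [apply Rabs_sum1|].
  apply Rle_trans with (sum1 (fun _ => D * INR (Q n)) (Q n - 1)).
  + apply sum1_le; intros r Hr; apply H0; lia.
  + rewrite sum1_const; apply Rmult_le_compat_r; lra.
Qed.

End CotangentSums.

(** * The product up to a denominator *)

Lemma sudler_ge0 (beta : R) (N : nat) : 0 <= sudler beta N.
Proof.
induction N as [|N IH]; [simpl; lra|].
apply Rmult_le_pos; [easy|apply Rabs_pos].
Qed.

Lemma half_ln_sqr (x : R) : x <> 0 -> / 2 * ln (x ^ 2) = ln (Rabs x).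
Proof.
intros Hx; rewrite <- pow2_abs; assert (H := Rabs_pos_lt x Hx).
replace (Rabs x ^ 2) with (Rabs x * Rabs x) by ring; rewrite ln_mult; lra.
Qed.

(* Written with a square to make it differentiable in [al]. *)
Definition ln_sudler (N : nat) (al : R) : R :=
  sum1 (fun r => / 2 * ln ((2 * sin (PI * (INR r * al))) ^ 2)) N.

Lemma ln_sudler_eq (N : nat) (al : R) :
  (forall r, (1 <= r <= N)%nat -> sin (PI * (INR r * al)) <> 0) ->
  0 < sudler al N /\ ln_sudler N al = ln (sudler al N).
Proof.
unfold ln_sudler; induction N as [|N IH]; intros H.
- cbn; rewrite ln_1; lra.
- cbn [sum1 sudler]; destruct IH as [IH1 IH2]; [intros; apply H; lia|].
  rewrite Rmult_assoc, IH2, half_ln_sqr.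
  2:{ assert (Hs := H (S N)); apply Rmult_integral_contrapositive; split; [lra|apply Hs; lia]. }
  assert (0 < Rabs (2 * sin (PI * (INR (S N) * al)))).
  { apply Rabs_pos_lt, Rmult_integral_contrapositive; split; [lra|apply H; lia]. }
  split; [now apply Rmult_lt_0_compat|]; now rewrite ln_mult.
Qed.

Lemma is_derive_ln_sudler (N : nat) (al : R) :
  (forall r, (1 <= r <= N)%nat -> sin (PI * (INR r * al)) <> 0) ->
  is_derive (ln_sudler N) al
    (PI * sum1 (fun r => INR r * cot (PI * (INR r * al))) N).
Proof.
unfold ln_sudler; induction N as [|N IH]; intros H.
- cbn; rewrite Rmult_0_r; apply (is_derive_const 0).
- cbn [sum1]; rewrite Rmult_plus_distr_l; apply (is_derive_plus (V := R_NormedModule)).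
  + apply IH; intros; apply H; lia.
  + assert (Hs : sin (PI * (INR (S N) * al)) <> 0) by (apply H; lia).
    set (k := INR (S N)) in *; auto_derive.
    * apply pow2_gt_0, Rmult_integral_contrapositive; split; [lra|easy].
    * unfold cot; field; easy.
Qed.

Section Growth.

Variables (d : nat -> nat) (B : R).
Hypothesis d_ge1 : forall n, (1 <= n)%nat -> (1 <= d n)%nat.
Hypothesis d_leB : forall n, (1 <= n)%nat -> INR (d n) <= B.

Let Q (n : nat) : nat := denom d (S n).
Let P (n : nat) : nat := numer d (S n).
Let E := 8 * (B + 1) ^ 8.
Let D := 2 * (4 * E + 5 * E * (B + 1)).

(** The cotangent estimates use every scale k <= n. The condition holds for beta and for its n-th
    convergent and is convex, so it holds at the intermediate point given by the mean value
    theorem. *)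
Definition well_approx (n : nat) (al : R) : Prop :=
  forall k, (k <= n)%nat -> Rabs (INR (Q k) * al - INR (P k)) <= / INR (Q (S k)).

Lemma Q_pos (n : nat) : 0 < INR (Q n).
Proof. now apply q_pos. Qed.

Lemma sin_Q_le (n : nat) (al : R) :
  Rabs (INR (Q n) * al - INR (P n)) <= / INR (Q (S n)) ->
  Rabs (sin (PI * (INR (Q n) * al))) <= 4 / INR (Q (S n)).
Proof.
intros H; rewrite <- (sin_PI_sub_nat _ (P n)).
eapply Rle_trans; [apply Rabs_sin_le|]; rewrite Rabs_mult.
rewrite (Rabs_pos_eq PI) by (left; apply PI_RGT_0).
apply Rmult_le_compat; [left; apply PI_RGT_0|apply Rabs_pos|apply PI_4|easy].
Qed.

Lemma well_approx_sin_neq0 (n : nat) (al : R) :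
  well_approx n al -> forall r, (1 <= r < Q n)%nat -> sin (PI * (INR r * al)) <> 0.
Proof.
intros H r Hr Hs; unfold Q in Hr.
destruct (sin_lower d d_ge1 B d_leB n r al (H n (le_n _)) ltac:(lia)) as [Hu H1].
rewrite Hs, Rabs_R0 in H1; revert H1; apply Rlt_not_le.
assert (HB := B_ge1 d d_ge1 B d_leB).
apply Rmult_lt_0_compat; [|apply Rmult_lt_0_compat; lra].
apply pow_lt, Rinv_0_lt_compat, pow_lt; lra.
Qed.

Lemma derivative_bound (n : nat) (al : R) :
  well_approx n al ->
  Rabs (sum1 (fun r => INR r * cot (PI * (INR r * al))) (Q n - 1)) <= D * INR (Q n) ^ 2.
Proof.
intros H; assert (HB := B_ge1 d d_ge1 B d_leB).
apply weighted_cot_sum_le.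
- reflexivity.
- intros k; now apply denom_le_S.
- intros k; now apply q_SS_le.
- lra.
- unfold E; assert (1 <= (B + 1) ^ 8) by (apply pow_R1_Rle; lra); lra.
- intros k Hk; now apply sin_Q_le, H.
- intros k Hk; now apply (sum_inv_sin_sqr d d_ge1 B d_leB), H.
- now apply well_approx_sin_neq0.
Qed.

Lemma well_approx_convex (n : nat) (x y z : R) :
  well_approx n x -> well_approx n y -> Rmin x y <= z <= Rmax x y -> well_approx n z.
Proof.
intros Hx Hy Hz k Hk; specialize (Hx k Hk); specialize (Hy k Hk).
assert (HQ := Q_pos k).
apply Rabs_le_between in Hx; apply Rabs_le_between in Hy; apply Rabs_le.
destruct (Rle_dec x y); [rewrite Rmin_left, Rmax_right in Hz by easy|
  rewrite Rmin_right, Rmax_left in Hz by lra]; nra.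
Qed.

Lemma well_approx_cfrac (n : nat) : well_approx n (cfrac d).
Proof. intros k _; now apply cfrac_dist. Qed.

Lemma convergent_well_approx (n : nat) :
  INR (Q n) * cfrac_fin (map d (seq 1 n)) = INR (P n) /\
  well_approx n (cfrac_fin (map d (seq 1 n))).
Proof.
split.
- assert (H := cfrac_fin_tail d d_ge1 0 n); cbn [seq map cfrac_fin] in H.
  rewrite Nat.add_0_r in H; rewrite H; unfold P, Q.
  assert (HQ := Q_pos n); unfold Q in HQ; field; lra.
- intros k Hk; assert (H := convergent_dist d d_ge1 k (n - k)).
  now replace (k + (n - k))%nat with n in H by lia.
Qed.

(** Modulo 1 the points r P/Q are the s/Q with s the permuted residues, which reduces the sum to
    [sum_ln_sin]. *)
Lemma ln_sudler_convergent (n : nat) :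
  ln_sudler (Q n - 1) (cfrac_fin (map d (seq 1 n))) = ln (INR (Q n)).
Proof.
destruct (convergent_well_approx n) as [Hp Hw]; set (x := cfrac_fin _) in *.
assert (HQ := Q_pos n); assert (HQ1 : (1 <= Q n)%nat) by (now apply denom_ge).
rewrite <- sum_ln_sin by easy; unfold ln_sudler.
rewrite <- (sum1_perm (fun s => ln (2 * sin (PI * (INR s / INR (Q n))))) (residue d n));
  [|now apply residue_range|now apply residue_inj].
apply sum1_ext; intros r Hr.
assert (Hs : sin (PI * (INR r * x)) <> 0) by (apply (well_approx_sin_neq0 n); [easy|lia]).
rewrite half_ln_sqr by (apply Rmult_integral_contrapositive; split; [lra|easy]).
f_equal; rewrite Rabs_mult, Rabs_pos_eq by lra; f_equal.
set (m := ((r * P n) / Q n)%nat).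
replace (INR r * x) with (INR (residue d n r) / INR (Q n) + INR m).
2:{ apply Rmult_eq_reg_l with (INR (Q n)); [|lra].
    replace (INR (Q n) * (INR r * x)) with (INR r * INR (P n)) by (rewrite <- Hp; ring).
    replace (INR (Q n) * (INR (residue d n r) / INR (Q n) + INR m))
      with (INR (Q n) * INR m + INR (residue d n r)) by (field; lra).
    rewrite <- !mult_INR, <- plus_INR; f_equal; symmetry; apply Nat.div_mod; lia. }
rewrite sin_PI_add_nat; apply Rabs_pos_eq.
assert (Hres := residue_range d n r Hr); fold (Q n) in Hres.
assert (0 <= INR (residue d n r) / INR (Q n) <= 1).
{ split; [apply Rdiv_le_0_compat; [apply pos_INR|easy]|].
  apply Rle_div_l; [easy|]; rewrite Rmult_1_l; apply le_INR; lia. }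
assert (HPI := PI_RGT_0); apply sin_ge_0; nra.
Qed.

(** Mean value theorem for [ln_sudler] from the convergent, where the product is Q, to beta: the
    derivative is at most pi D Q^2, the distance at most 1/Q^2, and pi <= 4 gives the exponent
    4D. *)
Lemma sudler_pred_denom_ge (n : nat) :
  exp (- (4 * D)) * INR (Q n) <= sudler (cfrac d) (Q n - 1).
Proof.
destruct (convergent_well_approx n) as [Hp Hx]; set (x := cfrac_fin _) in *.
assert (Hb := well_approx_cfrac n); set (beta := cfrac d) in *.
assert (HQ := Q_pos n); assert (HQ' := Q_pos (S n)).
assert (HB := B_ge1 d d_ge1 B d_leB).
assert (HD : 0 <= D).
{ assert (0 <= (B + 1) ^ 8) by (apply pow_le; lra); unfold D, E; nra. }
destruct (ln_sudler_eq (Q n - 1) beta) as [Hpos Hln].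
{ intros r Hr; apply (well_approx_sin_neq0 n); [easy|lia]. }
assert (Hder : forall z, Rmin x beta <= z <= Rmax x beta ->
  is_derive (ln_sudler (Q n - 1)) z
    (PI * sum1 (fun r => INR r * cot (PI * (INR r * z))) (Q n - 1))).
{ intros z Hz; apply is_derive_ln_sudler; intros r Hr.
  apply (well_approx_sin_neq0 n); [|lia]; now apply (well_approx_convex n x beta). }
destruct (MVT_gen (ln_sudler (Q n - 1)) x beta
  (fun z => PI * sum1 (fun r => INR r * cot (PI * (INR r * z))) (Q n - 1)))
  as [z [Hz HMVT]].
{ intros z Hz; apply Hder; lra. }
{ intros z Hz; apply continuity_pt_filterlim, (ex_derive_continuous (V := R_NormedModule)).
  eexists; now apply Hder. }
unfold x in HMVT; rewrite ln_sudler_convergent, Hln in HMVT; fold x in HMVT.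
assert (Hs := derivative_bound n z (well_approx_convex n x beta z Hx Hb Hz)).
set (s := sum1 _ _) in *.
assert (Hdist : Rabs (beta - x) <= / INR (Q n) ^ 2).
{ assert (H := Hb n (le_n _)); rewrite <- Hp, <- Rmult_minus_distr_l, Rabs_mult in H.
  rewrite (Rabs_pos_eq (INR (Q n))) in H by lra.
  assert (/ INR (Q (S n)) <= / INR (Q n)).
  { apply Rinv_le_contravar; [easy|]; now apply le_INR, denom_le_S. }
  apply Rmult_le_reg_l with (INR (Q n)); [easy|].
  replace (INR (Q n) * / INR (Q n) ^ 2) with (/ INR (Q n)) by (field; lra); lra. }
assert (Hsmall : Rabs (PI * s * (beta - x)) <= 4 * D).
{ rewrite !Rabs_mult, (Rabs_pos_eq PI) by (left; apply PI_RGT_0).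
  replace (4 * D) with (4 * (D * INR (Q n) ^ 2) * / INR (Q n) ^ 2) by (field; lra).
  assert (HPI := PI_RGT_0).
  apply Rmult_le_compat; [|apply Rabs_pos| |easy].
  - apply Rmult_le_pos; [lra|apply Rabs_pos].
  - apply Rmult_le_compat; [lra|apply Rabs_pos|apply PI_4|easy]. }
apply Rabs_le_between in Hsmall.
rewrite <- (exp_ln (INR (Q n))) at 1 by easy; rewrite <- exp_plus.
rewrite <- (exp_ln (sudler beta _)) by easy.
apply Rnot_lt_le; intros Hlt; apply exp_lt_inv in Hlt; lra.
Qed.

End Growth.

(** * Small and large values *)

(** For x = M beta these are the factors M + 1, ..., M + N of a longer product. Only x modulo 1
    matters, so for M = q the shift may be replaced by q beta - p, which is small. *)
Fixpoint sudler_shift (beta x : R) (N : nat) : R :=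
  match N with
  | O => 1
  | S N' => sudler_shift beta x N' * Rabs (2 * sin (PI * (INR N * beta + x)))
  end.

Lemma sudler_shift_add_nat (beta x : R) (m N : nat) :
  sudler_shift beta (x + INR m) N = sudler_shift beta x N.
Proof.
induction N as [|N IH]; cbn [sudler_shift]; [easy|].
rewrite IH, !Rabs_mult, <- Rplus_assoc, sin_PI_add_nat; easy.
Qed.

Lemma sudler_add (beta : R) (M N : nat) :
  sudler beta (M + N) = sudler beta M * sudler_shift beta (INR M * beta) N.
Proof.
induction N as [|N IH]; [cbn; rewrite Nat.add_0_r; ring|].
rewrite Nat.add_succ_r; cbn [sudler sudler_shift]; rewrite IH, Rmult_assoc.
do 2 f_equal; do 2 f_equal; rewrite <- Nat.add_succ_r, plus_INR; f_equal; ring.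
Qed.

(** The top N factors read downwards: (M + 1 - r) beta is r beta - (M + 1) beta up to sign. With M +
    1 = q the shift is again small modulo 1. *)
Lemma sudler_reflect (beta : R) (M N : nat) :
  (N <= M)%nat ->
  sudler beta M = sudler beta (M - N) * sudler_shift beta (- (INR (S M) * beta)) N.
Proof.
induction N as [|N IH]; intros H; [cbn; rewrite Nat.sub_0_r; ring|].
rewrite IH by lia; replace (M - N)%nat with (S (M - S N)) by lia.
cbn [sudler sudler_shift].
replace (PI * (INR (S N) * beta + - (INR (S M) * beta)))
  with (- (PI * INR (S (M - S N)) * beta)).
- rewrite sin_neg, Ropp_mult_distr_r_reverse, Rabs_Ropp; ring.
- replace (S (M - S N)) with (S M - S N)%nat by lia; rewrite minus_INR by lia; ring.
Qed.

Lemma sudler_shift_cv (beta : R) (x : nat -> R) (N : nat) :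
  is_lim_seq x 0 -> is_lim_seq (fun m => sudler_shift beta (x m) N) (sudler beta N).
Proof.
intros Hx; induction N as [|N IH]; [apply is_lim_seq_const|].
cbn [sudler sudler_shift]; apply is_lim_seq_mult'; [easy|].
replace (PI * INR (S N) * beta) with (PI * (INR (S N) * beta + 0)) by ring.
apply (is_lim_seq_continuous (fun y => Rabs (2 * sin (PI * (INR (S N) * beta + y))))); [|easy].
apply continuity_pt_filterlim.
apply (continuous_comp (fun y => 2 * sin (PI * (INR (S N) * beta + y))) Rabs);
  [|apply continuous_Rabs].
apply (ex_derive_continuous (fun y => 2 * sin (PI * (INR (S N) * beta + y)))); auto_derive; easy.
Qed.

Section Limits.

Variables (d : nat -> nat) (B : R).
Hypothesis d_ge1 : forall n, (1 <= n)%nat -> (1 <= d n)%nat.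
Hypothesis d_leB : forall n, (1 <= n)%nat -> INR (d n) <= B.
Let Q (n : nat) : nat := denom d (S n).
Let P (n : nat) : nat := numer d (S n).
Let beta := cfrac d.

Lemma approx_error_cv : is_lim_seq (fun n => INR (Q n) * beta - INR (P n)) 0.
Proof.
apply is_lim_seq_abs_0.
apply is_lim_seq_le_le with (u := fun _ => 0) (w := fun n => / INR (S n)).
- intros n; split; [apply Rabs_pos|].
  eapply Rle_trans; [now apply cfrac_dist|].
  apply Rinv_le_contravar; [apply lt_0_INR; lia|apply le_INR].
  now apply denom_ge.
- apply is_lim_seq_const.
- apply (is_lim_seq_incr_1 (fun n => / INR n)).
  replace (Finite 0) with (Rbar_inv p_infty) by reflexivity.
  apply is_lim_seq_inv; [apply is_lim_seq_INR|easy].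
Qed.

Variables (phi : nat -> nat) (c : R).
Hypothesis phi_incr : forall m, (phi m < phi (S m))%nat.
Hypothesis sudler_cv : is_lim_seq (fun m => sudler beta (Q (phi m))) c.
Hypothesis c_lt1 : c < 1.

Lemma sudler_add_cv (N : nat) :
  is_lim_seq (fun m => sudler beta (Q (phi m) + N)) (c * sudler beta N).
Proof.
apply is_lim_seq_ext with
  (fun m => sudler beta (Q (phi m)) *
    sudler_shift beta (INR (Q (phi m)) * beta - INR (P (phi m))) N).
- intros m; rewrite sudler_add, <- (sudler_shift_add_nat _ _ (P (phi m))).
  do 2 f_equal; ring.
- apply is_lim_seq_mult'; [easy|apply sudler_shift_cv].
  apply (is_lim_seq_subseq (fun n => INR (Q n) * beta - INR (P n))).
  + now apply eventually_subseq.
  + apply approx_error_cv.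
Qed.

Lemma phi_ge (m : nat) : (m <= phi m)%nat.
Proof. induction m as [|m IH]; [lia|]; assert (H := phi_incr m); lia. Qed.

Lemma lim_lt_eventually (u : nat -> R) (l x : R) :
  is_lim_seq u l -> l < x -> eventually (fun m => u m < x).
Proof.
intros Hu Hl; apply is_lim_seq_spec in Hu; unfold is_lim_seq' in Hu.
destruct (Hu (mkposreal (x - l) ltac:(lra))) as [N HN]; exists N; intros m Hm.
specialize (HN m Hm); cbn in HN; apply Rabs_lt_between in HN; lra.
Qed.

Lemma sudler_small (eps : R) (N0 : nat) :
  0 < eps -> exists N, (N0 <= N)%nat /\ sudler beta N < eps.
Proof.
(* The midpoint of max(c, 0) and 1; the maximum makes c' positive without knowledge of the sign of
   c. *)
intros Heps; set (c' := (Rmax c 0 + 1) / 2).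
assert (Hc' : Rmax c 0 < c' /\ 0 < c' < 1) by (unfold c', Rmax; destruct (Rle_dec c 0); lra).
assert (Hpow : forall r, exists N, sudler beta N <= c' ^ r).
{ induction r as [|r [N HN]]; [exists O; simpl; lra|].
  destruct (lim_lt_eventually _ _ (c' ^ S r) (sudler_add_cv N)) as [m Hm].
  - assert (H0 := sudler_ge0 beta N); assert (Hr : 0 < c' ^ r) by (apply pow_lt; lra).
    assert (Hm0 := Rmax_r c 0).
    apply Rle_lt_trans with (Rmax c 0 * sudler beta N);
      [apply Rmult_le_compat_r; [easy|apply Rmax_l]|simpl; nra].
  - exists (Q (phi m) + N)%nat; left; apply Hm; lia. }
destruct (pow_lt_1_zero c' ltac:(apply Rabs_lt_between; lra) eps Heps) as [r Hr].
destruct (Hpow r) as [N HN].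
specialize (Hr r (le_n _)); rewrite Rabs_pos_eq in Hr by (apply pow_le; lra).
(* One more denominator, taken large, pushes the index beyond N0; since c < 1 the value stays below
   eps. *)
destruct (lim_lt_eventually _ _ eps (sudler_add_cv N)) as [m Hm].
{ assert (H0 := sudler_ge0 beta N); nra. }
exists (Q (phi (m + N0)) + N)%nat; split; [|apply Hm; lia].
assert (H1 := phi_ge (m + N0)); destruct (denom_ge d d_ge1 (phi (m + N0))) as [H2 _].
unfold Q; lia.
Qed.

(** Write P_{q-1} as P_M times its top N1 factors, M = q - 1 - N1. These tend to P_{N1} < eps as q
    grows, so P_{q-1} >= a q forces P_M >= a q / eps. *)
Lemma sudler_large (K : R) (N0 : nat) :
  exists N, (N0 <= N)%nat /\ K < sudler beta N / INR N.
Proof.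
(* The constant exp(-4D) of [sudler_pred_denom_ge], with [D] and [E] written out. *)
set (a := exp (- (4 * (2 * (4 * (8 * (B + 1) ^ 8) + 5 * (8 * (B + 1) ^ 8) * (B + 1)))))).
assert (Ha : 0 < a) by apply exp_pos.
assert (HK := Rle_abs K); assert (HK0 := Rabs_pos K).
(* Chosen so that a q / eps = 2(|K| + 1) q, which exceeds K M because M < q. *)
set (eps := a / (2 * (Rabs K + 1))).
assert (Heps : 0 < eps) by (apply Rdiv_lt_0_compat; lra).
destruct (sudler_small eps 0 Heps) as [N1 [_ HN1]].
assert (Hsh : is_lim_seq
  (fun n => sudler_shift beta (- (INR (Q n) * beta - INR (P n))) N1) (sudler beta N1)).
{ apply sudler_shift_cv; replace (Finite 0) with (Rbar_opp 0) by (simpl; now rewrite Ropp_0).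
  apply -> is_lim_seq_opp; apply approx_error_cv. }
destruct (lim_lt_eventually _ _ _ Hsh HN1) as [m Hm].
(* The size of Q_n guarantees M >= N0 and M >= 1. *)
assert (Hn : exists n, (m <= n)%nat /\ (N0 + N1 + 2 <= Q n)%nat).
{ exists (m + N0 + N1 + 2)%nat; split; [lia|].
  destruct (denom_ge d d_ge1 (m + N0 + N1 + 2)) as [Hn _]; unfold Q; lia. }
destruct Hn as [n [Hmn HnQ]]; specialize (Hm n Hmn).
set (M := (Q n - 1 - N1)%nat).
assert (HM : 1 <= INR M) by (apply (le_INR 1); unfold M; lia).
exists M; split; [unfold M; lia|].
assert (Hlow := sudler_pred_denom_ge d B d_ge1 d_leB n).
change (a * INR (Q n) <= sudler beta (Q n - 1)) in Hlow.
rewrite (sudler_reflect beta (Q n - 1) N1) in Hlow by lia; fold M in Hlow.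
replace (S (Q n - 1)) with (Q n) in Hlow by lia.
replace (- (INR (Q n) * beta - INR (P n))) with (- (INR (Q n) * beta) + INR (P n)) in Hm by ring.
rewrite sudler_shift_add_nat in Hm.
set (s := sudler_shift _ _ _) in *; assert (HP := sudler_ge0 beta M).
assert (HQ : INR M < INR (Q n)) by (apply lt_INR; unfold M; lia).
assert (Hbig : INR (Q n) * (2 * (Rabs K + 1)) <= sudler beta M).
{ apply Rmult_le_reg_l with eps; [easy|].
  replace (eps * (INR (Q n) * (2 * (Rabs K + 1)))) with (a * INR (Q n))
    by (unfold eps; field; lra).
  nra. }
apply Rlt_div_r; [lra|]; nra.
Qed.

End Limits.

(** * Eventually periodic digits and the conclusion *)

Lemma ev_periodic_pos (h l : nat) (b a : nat -> nat) :
  (1 <= l)%nat ->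
  (forall i, (1 <= i <= h)%nat -> (0 < b i)%nat) ->
  (forall i, (1 <= i <= l)%nat -> (0 < a i)%nat) ->
  forall n, (1 <= n)%nat -> (1 <= ev_periodic h l b a n)%nat.
Proof.
intros Hl Hb Ha n Hn; unfold ev_periodic; destruct (Nat.leb_spec n h).
- apply Hb; lia.
- apply Ha; assert (H1 := Nat.mod_upper_bound (n - h - 1) l); lia.
Qed.

Lemma bounded_prefix (f : nat -> nat) (n : nat) :
  exists b, forall i, (i <= n)%nat -> (f i <= b)%nat.
Proof.
induction n as [|n [b Hb]]; [exists (f 0%nat); intros i Hi; now replace i with 0%nat by lia|].
exists (Nat.max b (f (S n))); intros i Hi.
destruct (Nat.eq_dec i (S n)) as [->|H]; [lia|].
specialize (Hb i ltac:(lia)); lia.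
Qed.

(** Supplies the digit bound [B], that is, the bad approximability of beta. *)
Lemma ev_periodic_bounded (h l : nat) (b a : nat -> nat) :
  (1 <= l)%nat -> exists B, forall n, (ev_periodic h l b a n <= B)%nat.
Proof.
intros Hl; destruct (bounded_prefix b h) as [B1 H1], (bounded_prefix a l) as [B2 H2].
exists (Nat.max B1 B2); intros n; unfold ev_periodic; destruct (Nat.leb_spec n h).
- specialize (H1 n ltac:(lia)); lia.
- assert (H3 := Nat.mod_upper_bound (n - h - 1) l ltac:(lia)).
  specialize (H2 (S ((n - h - 1) mod l)) ltac:(lia)); lia.
Qed.

Theorem theorem2 (h l : nat) (hl : (1 <= l)%nat)
  (b a : nat -> nat)
  (hb : forall i : nat, (1 <= i <= h)%nat -> (0 < b i)%nat)
  (ha : forall i : nat, (1 <= i <= l)%nat -> (0 < a i)%nat)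
  (beta : R) (hbeta : beta = cfrac (ev_periodic h l b a))
  (C : nat -> R)
  (hC : forall k : nat, (1 <= k <= l)%nat ->
     is_lim_seq
       (fun m : nat => sudler beta (denom (ev_periodic h l b a) (h + m * l + k)))
       (Finite (C k)))
  (k0 : nat) (hk0 : (1 <= k0 <= l)%nat) (hC0 : C k0 < 1) :
  LimInf_seq (fun N : nat => sudler beta N) = Finite 0 /\
  LimSup_seq (fun N : nat => sudler beta N / INR N) = p_infty.
Proof.
subst beta; set (d := ev_periodic h l b a) in *.
assert (Hd : forall n, (1 <= n)%nat -> (1 <= d n)%nat) by now apply ev_periodic_pos.
destruct (ev_periodic_bounded h l b a hl) as [B HB]; fold d in HB.
assert (HdB : forall n, (1 <= n)%nat -> INR (d n) <= INR B) by (intros; apply le_INR, HB).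
(* The estimates index denominators as [denom d (S n)], hence the - 1; it is a true subtraction
   because k0 >= 1. *)
set (phi := fun m => (h + m * l + k0 - 1)%nat).
assert (Hphi : forall m, (phi m < phi (S m))%nat) by (intros m; unfold phi; nia).
assert (Hcv : is_lim_seq (fun m => sudler (cfrac d) (denom d (S (phi m)))) (C k0)).
{ apply is_lim_seq_ext with (2 := hC k0 hk0).
  intros m; do 2 f_equal; unfold phi; lia. }
split.
- apply is_LimInf_seq_unique; intros eps; split.
  + intros N0; destruct (sudler_small d Hd phi (C k0) Hphi Hcv hC0 eps N0 (cond_pos eps))
      as [N [HN HN']]; exists N; split; [easy|lra].
  + exists O; intros n _; assert (H := sudler_ge0 (cfrac d) n); generalize (cond_pos eps); lra.
- apply is_LimSup_seq_unique; intros K N0.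
  destruct (sudler_large d (INR B) Hd HdB phi (C k0) Hphi Hcv hC0 K N0) as [N [HN HN']].
  now exists N.
Qed.
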